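(* Let $0<q<1$ and $N\ge 1$. Let $F_{-1},F_0,F_1$ be polynomials in $z^{-1}$ with coefficients in $\mathrm{Mat}_N(\mathbb{C})$, and suppose that the $q$-difference operator $$(DP)(z)=P(q^{-1}z)F_{-1}(z)+P(z)F_0(z)+P(qz)F_1(z)$$ maps $\mathbb{P}[z]$ into $\mathbb{P}[z]$. Let $W$ be a $q$-weight matrix. Suppose that $$F_0(q^x)W(q^x)=W(q^x)F_0(q^x)^*,\quad x\in\mathbb{N},$$ $$F_1(q^{x-1})W(q^{x-1})=q\,W(q^x)F_{-1}(q^x)^*,\quad x\in\mathbb{N}\setminus\{0\},$$ and that the boundary conditions $$W(1)F_{-1}(1)^*=0,$$ $$q^{2x}F_1(q^x)W(q^x)\to 0\quad\text{as }x\to\infty,$$ $$q^{x}\bigl(F_1(q^x)W(q^x)-W(q^x)F_1(q^x)^*\bigr)\to 0\quad\text{as }x\to\infty$$ hold. Then $D$ is symmetric with respect to $W$, i.e. $\langle DP,Q\rangle_W=\langle P,DQ\rangle_W$ for all $P,Q\in\mathbb{P}[z]$.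
   Context: $\mathbb{N}=\{0,1,2,\dots\}$. $\mathbb{P}[z]$ is the space of polynomials in $z$ with coefficients in $\mathrm{Mat}_N(\mathbb{C})$. A $q$-weight matrix $W$ assigns to each $q^x$, $x\in\mathbb{N}$, a positive definite Hermitian matrix $W(q^x)\in\mathrm{Mat}_N(\mathbb{C})$ such that all moments $\sum_{x=0}^\infty q^x q^{nx}W(q^x)$, $n\ge0$, converge; the associated matrix-valued inner product is $$\langle P,Q\rangle_W=\sum_{x=0}^\infty q^x P(q^x)W(q^x)Q(q^x)^*\in\mathrm{Mat}_N(\mathbb{C}).$$ Limits $x\to\infty$ are along $x\in\mathbb{N}$. *)

(* Defs.v *)
From HB Require Import structures.
From mathcomp Require Import all_boot all_order all_algebra.
From mathcomp Require Import complex.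
From mathcomp Require Import all_classical all_reals all_analysis.

Set Implicit Arguments.
Unset Strict Implicit.
Unset Printing Implicit Defensive.

Import Order.TTheory GRing.Theory Num.Theory.
Import numFieldNormedType.Exports.

Local Open Scope classical_set_scope.
Local Open Scope ring_scope.
Local Open Scope complex_scope.
Local Open Scope sesquilinear_scope.

(* R[i] packaged as a numClosedFieldType: the topology that MathComp-Analysis
   puts on numeric fields (hence on matrices) is found through this structure,
   and is not inferred on the bare type R[i]. *)
Definition CC (R : realType) : numClosedFieldType := R[i].

Definition qpt (R : realType) (q : R) (x : nat) : CC R := q%:C ^+ x.

(* In the order of CC R, 0 < z entails that z is real. *)
Definition posdefmx (R : realType) (n : nat) (A : 'M[CC R]_n) : Prop :=
  A \is hermsymmx /\
  forall v : 'cV[CC R]_n, v != 0 -> 0 < (v^t* *m A *m v) 0 0.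

(* Mat_N(C) is 'M[CC R]_n.+1 with N = n.+1, the polynomials over it are
   {poly 'M[CC R]_n.+1}, and a complex point z is substituted for the central
   variable as the scalar matrix z%:M. *)
Definition peval (R : realType) (n : nat) (P : {poly 'M[CC R]_n.+1})
    (z : CC R) : 'M[CC R]_n.+1 :=
  P.[z%:M].

(* F stands for the polynomial in z^-1 with the same coefficients. *)
Definition pinveval (R : realType) (n : nat) (F : {poly 'M[CC R]_n.+1})
    (z : CC R) : 'M[CC R]_n.+1 :=
  F.[(z^-1)%:M].

Definition qweight (R : realType) (n : nat) (q : R)
    (W : CC R -> 'M[CC R]_n.+1) : Prop :=
  (forall x : nat, posdefmx (W (qpt q x))) /\
  (forall k : nat,
     cvgn (series (fun x : nat =>
       (qpt q x * qpt q (k * x)) *: W (qpt q x)))).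

(* Defined on arbitrary functions, since a Laurent polynomial such as DP is only
   known to be a polynomial by hypothesis; f and g are only read at the q^x. *)
Definition qinner (R : realType) (n : nat) (q : R)
    (W f g : CC R -> 'M[CC R]_n.+1) : 'M[CC R]_n.+1 :=
  limn (series (fun x : nat =>
    qpt q x *: (f (qpt q x) *m W (qpt q x) *m (g (qpt q x))^t*))).

Definition qdiffop (R : realType) (n : nat) (q : R)
    (Fm1 F0 F1 : {poly 'M[CC R]_n.+1}) (f : CC R -> 'M[CC R]_n.+1)
    (z : CC R) : 'M[CC R]_n.+1 :=
  f (q%:C^-1 * z) *m pinveval Fm1 z + f z *m pinveval F0 z
  + f (q%:C * z) *m pinveval F1 z.

(* z = 0 is excluded because T (peval P) may be a Laurent expression, to which
   the convention 0^-1 = 0 gives a meaningless value there. *)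
Definition preserves_poly (R : realType) (n : nat)
    (T : (CC R -> 'M[CC R]_n.+1) -> CC R -> 'M[CC R]_n.+1) : Prop :=
  forall P : {poly 'M[CC R]_n.+1}, exists S : {poly 'M[CC R]_n.+1},
    forall z : CC R, z != 0 -> T (peval P) z = peval S z.

Definition qsymmetric (R : realType) (n : nat) (q : R)
    (W : CC R -> 'M[CC R]_n.+1)
    (T : (CC R -> 'M[CC R]_n.+1) -> CC R -> 'M[CC R]_n.+1) : Prop :=
  forall P Q : {poly 'M[CC R]_n.+1},
    qinner q W (T (peval P)) (peval Q) = qinner q W (peval P) (T (peval Q)).

(* Main.v *)
Require Import Defs.
From HB Require Import structures.
From mathcomp Require Import all_boot all_order all_algebra.
From mathcomp Require Import complex.
From mathcomp Require Import all_classical all_reals all_analysis.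

Set Implicit Arguments.
Unset Strict Implicit.
Unset Printing Implicit Defensive.

Import Order.TTheory GRing.Theory Num.Theory.
Import numFieldNormedType.Exports.

Local Open Scope classical_set_scope.
Local Open Scope ring_scope.
Local Open Scope complex_scope.
Local Open Scope sesquilinear_scope.

(** The sum of the series for <DP,Q>_W minus that for <P,DQ>_W telescopes.  Put
a_x = q^x F_1(q^x) W(q^x).  The second symmetry equation, conjugated, says that
q^x F_(-1)(q^x) W(q^x) = a_(x-1)^* for x > 0, so the F_(-1) terms at x are
F_1 terms at x - 1 with the roles of P and Q exchanged; the F_0 terms cancel by
the first symmetry equation; at x = 0 the F_(-1) terms vanish by the condition
at 1.  By [concomitant_lagrange] the difference of the sums over 0, ..., x is
therefore the single boundary term

  U_x = P(q^(x+1)) a_x Q(q^x)^* - P(q^x) a_x^* Q(q^(x+1))^*,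

and it remains to see that U_x tends to 0.  By [concomitantE] it splits into two
terms in which a_x is multiplied by an increment P(q^(x+1)) - P(q^x) or
Q(q^(x+1)) - Q(q^x), and one term in a_x - a_x^*.  An increment of a polynomial
between q^x and q^(x+1) is q^x times a bounded factor ([cvg0_peval_incrM]), so
the first two are controlled by q^x a_x; the factors P(q^x), Q(q^x) stay bounded
([cvg0_pevalM], [cvg0_Mpeval]).  The two conditions at infinity say exactly that
q^x a_x and a_x - a_x^* tend to 0. *)

(** * Limits of matrix-valued functions *)

Lemma cvg_mxP (K : numFieldType) (m n : nat) (T : Type) (F : set_system T)
    {FF : Filter F} (f : T -> 'M[K]_(m.+1, n.+1)) (A : 'M[K]_(m.+1, n.+1)) :
  f @ F --> A <-> forall i j, (fun x => f x i j) @ F --> A i j.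
Proof.
split=> [fA i j|fA].
  by have := @coord_continuous K m.+1 n.+1 i j A; move: fA; apply: cvg_comp.
apply/cvg_ballP => e e0.
have H : \forall x \near F, forall i j, ball (A i j) e (f x i j).
  apply: filter_forall => i; apply: filter_forall => j.
  by move/cvg_ballP: (fA i j); apply.
by apply: filterS H => x H; split.
Qed.

Lemma cvg_mulmx (K : numFieldType) (m n p : nat) (T : Type) (F : set_system T)
    {FF : Filter F} (f : T -> 'M[K]_(m.+1, n.+1)) (g : T -> 'M[K]_(n.+1, p.+1))
    (A : 'M[K]_(m.+1, n.+1)) (B : 'M[K]_(n.+1, p.+1)) :
  f @ F --> A -> g @ F --> B -> (fun x => f x *m g x) @ F --> A *m B.
Proof.
move=> /cvg_mxP fA /cvg_mxP gB; apply/cvg_mxP => i j.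
rewrite mxE; under eq_fun do rewrite mxE.
by apply: cvg_big => [|k _]; [exact: add_continuous | apply: cvgM].
Qed.

Lemma cvg_adjmx (C : numClosedFieldType) (m n : nat) (T : Type)
    (F : set_system T) {FF : Filter F} (f : T -> 'M[C]_(m.+1, n.+1))
    (A : 'M[C]_(m.+1, n.+1)) :
  f @ F --> A -> (fun x => (f x)^t*) @ F --> A^t*.
Proof.
move=> /cvg_mxP fA; apply/cvg_mxP => i j.
rewrite !mxE; under eq_fun do rewrite !mxE.
apply/cvgrPdist_lt => e e0.
move/cvgrPdist_lt: (fA j i) => /(_ e e0); apply: filterS => x.
by rewrite -rmorphB norm_conjC.
Qed.

Lemma cvg0_scale_le1 (K : numFieldType) (V : normedModType K) (T : Type)
    (F : set_system T) {FF : Filter F} (z : T -> K) (f : T -> V) :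
  (forall x, `|z x| <= 1) -> f @ F --> (0 : V) ->
  (fun x => z x *: f x) @ F --> (0 : V).
Proof.
move=> z1 /cvgr0Pnorm_lt f0; apply/cvgr0Pnorm_lt => e e0.
apply: filterS (f0 e e0) => x; apply: le_lt_trans.
by rewrite normrZ ler_piMl.
Qed.

(** Two functions whose difference is null converge to the same points, so the
equality of [lim] holds even if neither of them converges. *)
Lemma eq_lim_sub0 (K : numFieldType) (V : normedModType K) (T : Type)
    (F : set_system T) {FF : Filter F} (f g : T -> V) :
  (f - g) @ F --> (0 : V) -> lim (f @ F) = lim (g @ F).
Proof.
move=> fg0; rewrite /lim /lim_in; congr (get _).
apply/funext => l; apply/propext; split; last exact: cvg_sub0.
by apply: cvg_sub0; rewrite -opprB -(oppr0 V); exact: cvgN.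
Qed.

Lemma seriesB_telescope (V : zmodType) (t1 t2 U : nat -> V) :
  t1 0 - t2 0 = U 0 -> (forall x, t1 x.+1 - t2 x.+1 = U x.+1 - U x) ->
  forall x, series t1 x.+1 - series t2 x.+1 = U x.
Proof.
move=> t0 tS; elim=> [|x IH]; first by rewrite /series /= !big_nat1.
by rewrite [series t1 _]seriesSr [series t2 _]seriesSr opprD addrACA IH tS addrC
  subrK.
Qed.

(** * Polynomial factors at bounded points *)

Lemma pevalMXaddC (R : realType) (n : nat) (p : {poly 'M[CC R]_n.+1})
    (c : 'M[CC R]_n.+1) (z : CC R) :
  peval (p * 'X + c%:P) z = z *: peval p z + c.
Proof. by rewrite /peval hornerMXaddC -scalemx1 -scalerAr mulr1. Qed.

Lemma peval0 (R : realType) (n : nat) (z : CC R) :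
  peval (0 : {poly 'M[CC R]_n.+1}) z = 0.
Proof. exact: horner0. Qed.

(** A polynomial is bounded on the unit disc; Horner induction gives the
consequence for null sequences directly, without an explicit bound. *)
Lemma cvg0_pevalM (R : realType) (n : nat) (P : {poly 'M[CC R]_n.+1})
    (z : nat -> CC R) (u : nat -> 'M[CC R]_n.+1) :
  (forall x, `|z x| <= 1) -> u @ \oo --> (0 : 'M[CC R]_n.+1) ->
  (fun x => peval P (z x) *m u x) @ \oo --> (0 : 'M[CC R]_n.+1).
Proof.
move=> z1 u0; elim/poly_ind: P => [|p c IH].
  by under eq_fun do rewrite peval0 mul0mx; exact: cvg_cst.
under eq_fun do rewrite pevalMXaddC mulmxDl -scalemxAl.
rewrite -[0]addr0; apply: cvgD; first exact: cvg0_scale_le1.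
have := @cvg_mulmx _ _ _ _ _ _ _ (fun=> c) u c 0 (cvg_cst _) u0.
by rewrite mulmx0; apply.
Qed.

Lemma cvg0_Mpeval (R : realType) (n : nat) (P : {poly 'M[CC R]_n.+1})
    (z : nat -> CC R) (u : nat -> 'M[CC R]_n.+1) :
  (forall x, `|z x| <= 1) -> u @ \oo --> (0 : 'M[CC R]_n.+1) ->
  (fun x => u x *m (peval P (z x))^t*) @ \oo --> (0 : 'M[CC R]_n.+1).
Proof.
move=> z1 /cvg_adjmx; rewrite trmx0 map_mx0 => /(cvg0_pevalM P z1) /cvg_adjmx.
rewrite trmx0 map_mx0.
by under eq_fun do rewrite trmx_mul map_mxM trmxCK.
Qed.

(** * The points q^x *)

Lemma qptS (R : realType) (q : R) (x : nat) : qpt q x.+1 = q%:C * qpt q x.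
Proof. exact: exprS. Qed.

Lemma qC_neq0 (R : realType) (q : R) (hq : 0 < q < 1) : (q%:C : CC R) != 0.
Proof. by case/andP: hq => q0 _; rewrite (inj_eq (@complexI R)) gt_eqF. Qed.

Lemma qVqptS (R : realType) (q : R) (hq : 0 < q < 1) (x : nat) :
  (q%:C : CC R)^-1 * qpt q x.+1 = qpt q x.
Proof. by rewrite qptS mulKf ?qC_neq0. Qed.

Lemma norm_qpt_le1 (R : realType) (q : R) (hq : 0 < q < 1) (x : nat) :
  `|qpt q x| <= 1.
Proof.
case/andP: hq => q0 q1; rewrite /qpt normrX exprn_ile1 //.
by rewrite ger0_norm ?lecR ?ltW.
Qed.

(** The increment P(qz) - P(z) is divisible by z: for P = p X + c it equals
z (q p(qz) - p(z)), where the constant term has cancelled.  At z = q^x this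
supplies the factor that makes u null. *)
Lemma cvg0_peval_incrM (R : realType) (q : R) (hq : 0 < q < 1) (n : nat)
    (P : {poly 'M[CC R]_n.+1}) (u : nat -> 'M[CC R]_n.+1) :
  (fun x => qpt q x *: u x) @ \oo --> (0 : 'M[CC R]_n.+1) ->
  (fun x => (peval P (qpt q x.+1) - peval P (qpt q x)) *m u x)
    @ \oo --> (0 : 'M[CC R]_n.+1).
Proof.
move=> u0; elim/poly_ind: P => [|p c _].
  by under eq_fun do rewrite !peval0 subrr mul0mx; exact: cvg_cst.
have E x : (peval (p * 'X + c%:P) (qpt q x.+1)
            - peval (p * 'X + c%:P) (qpt q x)) *m u x
    = q%:C *: (peval p (qpt q x.+1) *m (qpt q x *: u x))
      - peval p (qpt q x) *m (qpt q x *: u x).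
  rewrite !pevalMXaddC opprD addrACA subrr addr0 mulmxBl qptS.
  by rewrite -!scalemxAr -!scalemxAl scalerA.
under eq_fun do rewrite E.
rewrite -[0]subr0; apply: cvgB; last first.
  by apply: cvg0_pevalM => //; exact: norm_qpt_le1.
have : (fun x => peval p (qpt q x.+1) *m (qpt q x *: u x)) @ \oo
    --> (0 : 'M[CC R]_n.+1).
  by apply: cvg0_pevalM => // x; exact: norm_qpt_le1.
by move/(@cvgZl_tmp _ _ _ _ _ (q%:C : CC R)); rewrite scaler0.
Qed.

Lemma conj_qpt (R : realType) (q : R) (x : nat) : (qpt q x)^*%R = qpt q x.
Proof. by rewrite /qpt rmorphXn; congr (_ ^+ _); exact: conjc_real. Qed.

(** * The boundary term *)

Lemma adjmxZ (C : numClosedFieldType) (m n : nat) (a : C) (A : 'M[C]_(m, n)) :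
  (a *: A)^t* = a^*%R *: A^t*.
Proof. by rewrite linearZ /= map_mxZ. Qed.

Lemma adjmxM (C : numClosedFieldType) (m n p : nat) (A : 'M[C]_(m, n))
    (B : 'M[C]_(n, p)) : (A *m B)^t* = B^t* *m A^t*.
Proof. by rewrite trmx_mul map_mxM. Qed.

Lemma adjmxB (C : numClosedFieldType) (m n : nat) (A B : 'M[C]_(m, n)) :
  (A - B)^t* = A^t* - B^t*.
Proof. by rewrite linearB /= map_mxB. Qed.

Lemma adjmxD (C : numClosedFieldType) (m n : nat) (A B : 'M[C]_(m, n)) :
  (A + B)^t* = A^t* + B^t*.
Proof. by rewrite linearD /= map_mxD. Qed.

(** A discrete counterpart of the bilinear concomitant in Lagrange's identity,
for the values of P and Q at two neighbouring points. *)
Definition concomitant (C : numClosedFieldType) (n : nat)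
    (p0 p1 q0 q1 a : 'M[C]_n) : 'M[C]_n :=
  p1 *m a *m q0^t* - p0 *m a^t* *m q1^t*.

(** The discrete Lagrange identity, with the indices m, 0, 1 standing for the
points z / q, z, q z and w for the weight at z.  The f0 terms cancel because
f0 w is Hermitian; each other pair of terms is a concomitant, and the one on the
left interval appears with the opposite sign and the adjoint coefficient. *)
Lemma concomitant_lagrange (C : numClosedFieldType) (n : nat) (c : C)
    (pm p0 p1 qm q0 q1 fm f0 f1 w : 'M[C]_n)
    (hc : c^*%R = c) (hw : w^t* = w) (hf0 : f0 *m w = w *m f0^t*) :
  c *: ((pm *m fm + p0 *m f0 + p1 *m f1) *m w *m q0^t*)
    - c *: (p0 *m w *m (qm *m fm + q0 *m f0 + q1 *m f1)^t*)
  = concomitant p0 p1 q0 q1 (c *: (f1 *m w))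
    - concomitant pm p0 qm q0 ((c *: (fm *m w))^t*).
Proof.
rewrite /concomitant trmxCK !adjmxZ hc !adjmxD !adjmxM hw.
rewrite -!(scalemxAr, scalemxAl) -!scalerBr; congr (_ *: _).
rewrite !(mulmxDl, mulmxDr) !mulmxA -(mulmxA p0 f0) hf0 mulmxA.
by rewrite opprD addrACA opprD [X in X + _]addrACA subrr addr0 addrC opprB.
Qed.

(** Inserting p0 a q0^* and p0 a^* q0^* isolates the increments of P and Q and
the skew part of a, each of which is matched to one condition at infinity. *)
Lemma concomitantE (C : numClosedFieldType) (n : nat)
    (p0 p1 q0 q1 a : 'M[C]_n) :
  concomitant p0 p1 q0 q1 a
  = (p1 - p0) *m a *m q0^t* + p0 *m (a - a^t*) *m q0^t*
    - p0 *m ((q1 - q0) *m a)^t*.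
Proof.
rewrite adjmxM adjmxB !(mulmxBl, mulmxBr, mulmxA).
by rewrite addrA subrK opprB addrA subrK.
Qed.

Lemma cvg0_concomitant (R : realType) (n : nat) (q : R) (hq : 0 < q < 1)
    (P Q : {poly 'M[CC R]_n.+1}) (a : nat -> 'M[CC R]_n.+1) :
  (fun x => qpt q x *: a x) @ \oo --> (0 : 'M[CC R]_n.+1) ->
  (fun x => a x - (a x)^t*) @ \oo --> (0 : 'M[CC R]_n.+1) ->
  (fun x => concomitant (peval P (qpt q x)) (peval P (qpt q x.+1))
              (peval Q (qpt q x)) (peval Q (qpt q x.+1)) (a x))
    @ \oo --> (0 : 'M[CC R]_n.+1).
Proof.
move=> a0 skew0; have z1 := norm_qpt_le1 hq.
under eq_fun do rewrite concomitantE.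
rewrite -[0]subr0 -[X in X - _]addr0; apply: cvgB; first apply: cvgD.
- exact: (cvg0_Mpeval Q z1 (cvg0_peval_incrM hq P a0)).
- exact: (cvg0_Mpeval Q z1 (cvg0_pevalM P z1 skew0)).
apply: cvg0_pevalM => //.
move: (cvg0_peval_incrM hq Q a0) => /cvg_adjmx.
by rewrite trmx0 map_mx0; apply.
Qed.

(** * Symmetry of the operator *)

Theorem theorem3p5 (R : realType) (n : nat) (q : R)
    (Fm1 F0 F1 : {poly 'M[CC R]_n.+1}) (W : CC R -> 'M[CC R]_n.+1)
    (hq : 0 < q < 1)
    (hD : preserves_poly (qdiffop q Fm1 F0 F1))
    (hW : qweight q W)
    (h0 : forall x : nat,
       pinveval F0 (qpt q x) *m W (qpt q x)
       = W (qpt q x) *m (pinveval F0 (qpt q x))^t*)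
    (h1 : forall x : nat, (0 < x)%N ->
       pinveval F1 (qpt q x.-1) *m W (qpt q x.-1)
       = (q%:C : CC R) *: (W (qpt q x) *m (pinveval Fm1 (qpt q x))^t*))
    (hb1 : W 1 *m (pinveval Fm1 1)^t* = 0)
    (hb2 : (fun x : nat =>
              qpt q (2 * x) *: (pinveval F1 (qpt q x) *m W (qpt q x)))
           @ \oo --> (0 : 'M[CC R]_n.+1))
    (hb3 : (fun x : nat =>
              qpt q x *: (pinveval F1 (qpt q x) *m W (qpt q x)
                          - W (qpt q x) *m (pinveval F1 (qpt q x))^t*))
           @ \oo --> (0 : 'M[CC R]_n.+1)) :
  qsymmetric q W (qdiffop q Fm1 F0 F1).
Proof.
move=> P Q; rewrite /qinner.
pose a x := qpt q x *: (pinveval F1 (qpt q x) *m W (qpt q x)).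
pose b x := qpt q x *: (pinveval Fm1 (qpt q x) *m W (qpt q x)).
have WH x : (W (qpt q x))^t* = W (qpt q x).
  have [/(_ x)[+ _] _] := hW.
  by move/eqP; rewrite expr0 scale1r => <-.
have FW (F : {poly 'M[CC R]_n.+1}) x :
    W (qpt q x) *m (pinveval F (qpt q x))^t*
    = (pinveval F (qpt q x) *m W (qpt q x))^t*.
  by rewrite adjmxM WH.
have b0 : (b 0)^t* = 0 by rewrite adjmxZ -FW hb1 scaler0.
have bS x : (b x.+1)^t* = a x.
  rewrite adjmxZ conj_qpt -FW /a -[x in RHS]/(x.+1.-1) h1 //.
  by rewrite scalerA mulrC -qptS.
pose t1 x := qpt q x *: (qdiffop q Fm1 F0 F1 (peval P) (qpt q x)
  *m W (qpt q x) *m (peval Q (qpt q x))^t*).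
pose t2 x := qpt q x *: (peval P (qpt q x) *m W (qpt q x)
  *m (qdiffop q Fm1 F0 F1 (peval Q) (qpt q x))^t*).
pose U x := concomitant (peval P (qpt q x)) (peval P (qpt q x.+1))
  (peval Q (qpt q x)) (peval Q (qpt q x.+1)) (a x).
(* At x = 0 the point q^-1 q^x is not a lattice point; b 0 = 0 removes it. *)
have tE x : t1 x - t2 x = U x
    - concomitant (peval P (q%:C^-1 * qpt q x)) (peval P (qpt q x))
        (peval Q (q%:C^-1 * qpt q x)) (peval Q (qpt q x)) ((b x)^t*).
  by rewrite /U qptS; apply: concomitant_lagrange => //; exact: conj_qpt.
have t1Bt2 x : series t1 x.+1 - series t2 x.+1 = U x.
  apply: seriesB_telescope => {x} [|x].
    by rewrite tE b0 /concomitant trmx0 map_mx0 !(mul0mx, mulmx0) !subr0.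
  by rewrite tE (qVqptS hq x) bS.
have U0 : (fun x => U x) @ \oo --> (0 : 'M[CC R]_n.+1).
  apply: (cvg0_concomitant hq P Q).
    by under eq_fun do rewrite scalerA -exprD addnn -mul2n.
  by under eq_fun do rewrite adjmxZ conj_qpt -FW -scalerBr.
apply: eq_lim_sub0; rewrite -(cvg_shiftS (_ - _)).
by move: U0; under eq_fun do rewrite -t1Bt2.
Qed.
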